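(* Let $X$ be a submetrizable Tychonoff space. Then $C_p(X)$ is strongly Šanin, i.e., every infinite cardinal $\kappa$ with $\mathrm{cf}(\kappa)>\omega$ is a caliber for $C_p(X)$.
   Context: For a Tychonoff space $X$, $C_p(X)$ is the set of continuous functions $X\to\mathbb{R}$ with the topology of pointwise convergence (the subspace topology from $\mathbb{R}^X$). An infinite cardinal $\kappa$ is a caliber for a space $Z$ if for every set $I$ with $|I|=\kappa$ and every indexed family $\{U_\alpha:\alpha\in I\}$ of nonempty open subsets of $Z$ there is $J\subseteq I$ with $|J|=\kappa$ and $\bigcap_{\alpha\in J}U_\alpha\neq\emptyset$. A space is strongly Šanin if every infinite cardinal of uncountable cofinality is a caliber for it. A space $X$ is submetrizable if there is a continuous bijection from $X$ onto a metrizable space. *)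

(* Defs.v *)
From HB Require Import structures.
From mathcomp Require Import all_boot all_order all_algebra.
From mathcomp Require Import all_classical all_reals all_analysis.

Set Implicit Arguments.
Unset Strict Implicit.
Unset Printing Implicit Defensive.

Import Order.TTheory GRing.Theory Num.Theory.
Import numFieldNormedType.Exports.

Local Open Scope classical_set_scope.
Local Open Scope card_scope.

(** Cardinals are initial ordinals: a cardinal is given by a carrier type [K]
    with a (reflexive) well-order [le], no proper initial segment of which is
    equinumerous with [K]. *)
Definition is_cardinal (K : Type) (le : rel K) : Prop :=
  wochoice.well_order le /\
  forall x : K, [set y | le y x /\ y <> x] #!= [set: K].

Definition cofinal (K : Type) (le : rel K) (A : set K) : Prop :=
  forall x : K, exists2 y, A y & le x y.

(** The cofinality of [K] is the cardinality of such an [A]. *)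
Definition least_cofinal (K : Type) (le : rel K) (A : set K) : Prop :=
  cofinal le A /\ forall B : set K, cofinal le B -> A #<= B.

Definition uncountable_cofinality (K : Type) (le : rel K) : Prop :=
  exists2 A : set K, least_cofinal le A & ~ countable A.

(** Only the cardinality of [K] matters here. *)
Definition caliber (K : Type) (Z : topologicalType) : Prop :=
  forall (I : Type) (U : I -> set Z),
    [set: I] #= [set: K] ->
    (forall i, open (U i) /\ U i !=set0) ->
    exists J : set I, J #= [set: K] /\ \bigcap_(i in J) U i !=set0.

Definition strongly_sanin (Z : topologicalType) : Prop :=
  forall (K : Type) (le : rel K),
    is_cardinal le -> infinite_set [set: K] -> uncountable_cofinality le ->
    caliber K Z.

Definition tychonoff_space (X : topologicalType) : Prop :=
  completely_regular_space X /\ accessible_space X.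

(** A metrizable space is the topological space underlying some [metricType];
    the choice of a compatible metric is part of the existential. *)
Definition submetrizable (R : realType) (X : topologicalType) : Prop :=
  exists (Y : metricType R) (f : X -> Y), continuous f /\ bijective f.

(** [set_type] carries the subspace topology, here inherited from the product
    topology on the functions [X -> R]. *)
Definition Cp (R : realType) (X : topologicalType) : topologicalType :=
  set_type [set f : {ptws X -> R} | continuous (f : X -> R)].

(* Main.v *)
From Stdlib Require Import Inverse_Image.
Require Import Defs.
From mathcomp Require Import all_boot all_order all_algebra.
From mathcomp Require Import all_classical all_reals all_analysis.
From mathcomp Require Import lra.

(** Let phi be a continuous bijection from X onto a metric space Y, and let
    kappa be a cardinal of uncountable cofinality. A nonempty open set U_i of
    C_p(X) contains every continuous function taking suitable rational values
    at finitely many suitable points of X ([Cp_open_rational]). There are only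
    countably many choices for the list of rational values and for a natural
    number m such that the images under phi of the points for U_i are at
    mutual distance at least 1/(m+1); as cf(kappa) > omega, kappa many U_i
    share both ([large_fiber]). For these i, let x_a(i) be the image of the
    a-th point, where a < n. If, for kappa many i, the sets
    P_a = {x_a(i) : i} lie at a positive distance from each other, then a
    continuous function on Y takes the a-th rational value on all of P_a
    ([separated_interpolation]), and its composition with phi is in kappa many
    U_i.

    So everything rests on a combinatorial fact about metric spaces
    ([separation]): if dist (x i) (y i) >= e > 0 for kappa many i, then there
    are r > 0 and kappa many i such that dist (x i) (y j) >= r for all i and j
    among them. The n sequences are then treated one pair at a time
    ([separation_seq]). To prove the fact, choose indices greedily, each one
    r-compatible with those before. If this goes on for kappa steps, it yields
    the wanted set. Otherwise it stops at a set of fewer than kappa indices, so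
    that, up to exchanging x and y, kappa many x i are r-close to a set D with
    fewer than kappa points. If kappa many of the y i are not 2r-close to D,
    these indices are already separated ([separation_dominated]). Otherwise
    each remaining pair (x i, y i) is approximated by a code in D * D, a set
    with fewer than kappa elements. Then, even when kappa is singular, for
    every k < kappa some code is shared by more than k indices, and it suffices
    to separate the codes chosen for a cofinal set of k ([separation_coded]).
    This last problem lives on the regular cardinal cf(kappa)
    ([cofinal_separation]): either one ball contains the first (or the second)
    components of cofinally many codes, or each code conflicts only with a
    bounded set of codes, and then a greedy choice of length cf(kappa) succeeds
    ([cofinal_clique]).

    The cardinal arithmetic behind these steps is that a product of two sets
    smaller than kappa is smaller than kappa, which is Hessenberg's theorem on
    initial segments ([segment_square]). *)

Set Implicit Arguments.
Unset Strict Implicit.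
Unset Printing Implicit Defensive.

Import Order.TTheory GRing.Theory Num.Theory.
Import numFieldNormedType.Exports.

Local Open Scope classical_set_scope.
Local Open Scope card_scope.
Local Open Scope ring_scope.

(** * Cardinal comparison *)

Lemma card_le_inj T U (A : set T) (B : set U) (f : T -> U) :
  set_fun A B f -> set_inj A f -> A #<= B.
Proof.
move=> fAB finj; have /injfunPex[g] : exists2 f : T -> U, set_fun A B f & set_inj A f.
  by exists f.
exact: inj_card_le g.
Qed.

Lemma card_le_exists_inj T U (u0 : U) (A : set T) (B : set U) :
  A #<= B -> exists2 f : T -> U, set_fun A B f & set_inj A f.
Proof.
elim/Ppointed: U u0 B => U u0 B; first exact: any u0.
by move=> /pcard_leP AB; apply/injfunPex.
Qed.

Lemma card_le_sub_image T U (A : set T) (B : set U) (f : U -> T) :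
  A `<=` f @` B -> A #<= B.
Proof. by move=> /subset_card_le /card_le_trans; apply; exact: card_image_le. Qed.

Lemma card_le_setX T T' U U' (A : set T) (A' : set T') (B : set U) (B' : set U') :
  A #<= B -> A' #<= B' -> A `*` A' #<= B `*` B'.
Proof.
have [[b Bb]|/nonemptyPn ->] := pselect (B !=set0); last first.
  by move=> /card_le0P ->; rewrite set0X.
have [[b' Bb']|/nonemptyPn ->] := pselect (B' !=set0); last first.
  by move=> _ /card_le0P ->; rewrite setX0.
move=> /(card_le_exists_inj b)[f fAB finj] /(card_le_exists_inj b')[g gAB ginj].
apply: (@card_le_inj _ _ _ _ (fun p => (f p.1, g p.2))).
  by move=> [x y] [/= Ax Ay]; split; [apply: fAB|apply: gAB].
move=> [x y] [x' y'] /set_mem[/= Ax Ay] /set_mem[/= Ax' Ay'] [].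
by move=> /finj + /ginj; rewrite !inE => -> // ->.
Qed.

(** Hilbert's hotel: shift an infinite sequence of elements of [A] by one. *)
Lemma infinite_setU1 T (A : set T) (a : T) : infinite_set A -> a |` A #<= A.
Proof.
move=> /infiniteP /(card_le_exists_inj a)[f fA finj].
have fI n m : f n = f m -> n = m by move=> /finj; apply; rewrite inE.
pose g y := if y == f 0%N :> {classic T} then a
  else if pselect (exists n, y = f n.+1) is left ex then f (projT1 (cid ex)) else y.
apply: (@card_le_sub_image _ _ _ _ g) => x xaA; have [->|xa] := pselect (x = a).
  by exists (f 0%N); [exact: fA|rewrite /g eqxx].
have {xaA} Ax : A x by case: xaA.
have [[n xn]|nx] := pselect (exists n, x = f n).
  exists (f n.+1); first exact: fA.
  rewrite /g; case: eqP => [/fI//|_]; case: pselect => [ex|]; last by case; exists n.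
  by case: cid => m /= /fI [<-].
exists x => //; rewrite /g; case: eqP => [x0|_]; first by case: nx; exists 0%N.
by case: pselect => // -[n xn]; case: nx; exists n.+1.
Qed.

(** * Well-orders and greedy constructions *)

Definition strict_well_order W (lt : W -> W -> Prop) :=
  well_founded lt /\ forall x y, [\/ lt x y, x = y | lt y x].

Definition segment W (lt : W -> W -> Prop) (x : W) := [set y | lt y x].

Lemma strict_well_order_irr W (lt : W -> W -> Prop) x :
  strict_well_order lt -> ~ lt x x.
Proof. by move=> [wf _]; elim/(well_founded_ind wf): x => x IH xx; exact: (IH x). Qed.

Lemma strict_well_order_asym W (lt : W -> W -> Prop) x y :
  strict_well_order lt -> lt x y -> ~ lt y x.
Proof.
move=> [wf _]; elim/(well_founded_ind wf): x y => x IH y xy yx.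
exact: (IH y yx x).
Qed.

(** By trichotomy a counterexample would be a cycle of length 2 or 3, which
    well-foundedness excludes. *)
Lemma strict_well_order_trans W (lt : W -> W -> Prop) x y z :
  strict_well_order lt -> lt x y -> lt y z -> lt x z.
Proof.
move=> lto; have [wf tri] := lto.
elim/(well_founded_ind wf): x y z => x IH y z xy yz.
have asym := strict_well_order_asym lto.
case: (tri x z) => // [xz|zx]; first by subst z; case: (asym _ _ xy yz).
by case: (asym _ _ yz (IH z zx x y zx xy)).
Qed.

Lemma strict_well_order_pullback V W (lt : W -> W -> Prop) (f : V -> W) :
  injective f -> strict_well_order lt -> strict_well_order (fun x y => lt (f x) (f y)).
Proof.
move=> finj [wf tri]; split; first exact: wf_inverse_image.
move=> x y; case: (tri (f x) (f y)) => [?|/finj ?|?]; [by constructor 1|by constructor 2|by constructor 3].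
Qed.

Definition lexicographic A B (ltA : A -> A -> Prop) (ltB : B -> B -> Prop) p q :=
  ltA p.1 q.1 \/ p.1 = q.1 /\ ltB p.2 q.2.

Lemma strict_well_order_lexicographic A B (ltA : A -> A -> Prop) (ltB : B -> B -> Prop) :
  strict_well_order ltA -> strict_well_order ltB ->
  strict_well_order (lexicographic ltA ltB).
Proof.
move=> [wfA triA] [wfB triB]; split.
  move=> [a b]; elim/(well_founded_ind wfA): a b => a IHa b.
  elim/(well_founded_ind wfB): b => b IHb.
  by constructor => -[a' b'] [/= /IHa //|/= [-> /IHb]].
move=> [a b] [a' b']; rewrite /lexicographic /=.
case: (triA a a') => [?|->|?]; [by constructor 1; left| |by constructor 3; left].
by case: (triB b b') => [?|->|?]; [constructor 1; right|constructor 2|constructor 3; right].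
Qed.

Lemma strict_well_order_ex_max W (lt : W -> W -> Prop) x y :
  strict_well_order lt ->
  exists m, [/\ m = x \/ m = y, ~ lt m x & ~ lt m y].
Proof.
move=> lto; have [_ tri] := lto.
case: (tri x y) => [xy|<-|yx]; [exists y|exists x|exists x]; split; auto;
  solve [exact: strict_well_order_irr|exact: strict_well_order_asym].
Qed.

(** Choose [h w] by transfinite recursion, in [E w] and compatible with all the
    earlier values, whenever that is possible. A construction that gets stuck at
    some stage [w] is informative too: the values before [w] then conflict with
    all of [E w]. *)
Lemma greedy W I (lt : W -> W -> Prop) (i0 : I) (E : W -> set I) (C : I -> I -> Prop) :
  well_founded lt ->
  exists h : W -> I, forall w,
    (exists2 i, E w i & forall v, lt v w -> C (h v) i) ->
    E w (h w) /\ forall v, lt v w -> C (h v) (h w).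
Proof.
move=> wf.
pose step w (g : forall v, lt v w -> I) : I :=
  if pselect (exists i, E w i /\ forall v (vw : lt v w), C (g v vw) i) is left ex
  then projT1 (cid ex) else i0.
exists (Fix wf (fun=> I) step) => w [i Ei Ci].
have stepE : Fix wf (fun=> I) step w = step w (fun v _ => Fix wf (fun=> I) step v).
  apply: (Fix_eq wf (fun=> I) step) => x f g fg; congr step.
  by apply: functional_extensionality_dep => v; apply/funext => vx.
rewrite stepE /step; case: pselect => [ex|]; last by case; exists i.
by case: cid => j /= [].
Qed.

(** Enumerate [A] greedily without repetition along [W]: either all of [W] is
    used, or [A] is exhausted before some stage [w]. *)
Lemma well_order_comparability W (lt : W -> W -> Prop) T (A : set T) :
  strict_well_order lt ->
  [set: W] #<= A \/ exists w, A #<= segment lt w.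
Proof.
move=> [wf tri]; have [[w0 _]|W0] := pselect ([set: W] !=set0); last first.
  by left; move/nonemptyPn : W0 => ->; exact: card_ge0.
have [[a Aa]|/nonemptyPn ->] := pselect (A !=set0); last by right; exists w0; exact: card_ge0.
have [h hP] := greedy a (fun=> A) (fun i j => i <> j) wf.
have [total|] := pselect (forall w, exists2 i, A i & forall v, lt v w -> h v <> i).
  left; apply: (@card_le_inj _ _ _ _ h) => [w _|v w _ _ hvw].
    by have [] := hP w (total w).
  case: (tri v w) => // [vw|wv].
    by have [_ /(_ v vw)] := hP w (total w).
  by have [_ /(_ w wv)] := hP v (total v); rewrite hvw.
move=> /existsNP[w nw]; right; exists w; apply: (@card_le_sub_image _ _ _ _ h) => i Ai.
apply: contrapT => ni; apply: nw; exists i => // v vw hvi.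
by apply: ni; exists v.
Qed.

(** Hessenberg's theorem. If the segment below [x] is equinumerous with a shorter
    one, this is the induction hypothesis. Otherwise order its square by maximum,
    then lexicographically: the pairs preceding [p] all lie in the square of the
    segment up to the maximum of [p], which by induction is smaller than the
    segment below [x]. Comparability then embeds the square in that segment. *)
Lemma segment_square W (lt : W -> W -> Prop) x :
  strict_well_order lt -> infinite_set (segment lt x) ->
  segment lt x `*` segment lt x #<= segment lt x.
Proof.
move=> lto; have [wf tri] := lto.
elim/(well_founded_ind wf): x => x IH xinf.
have segS z : lt z x -> segment lt z `<=` segment lt x.
  by move=> zx y yz; exact: strict_well_order_trans zx.
have [[z zx xz]|init] := pselect (exists2 z, lt z x & segment lt x #<= segment lt z).
  have zinf : infinite_set (segment lt z) by apply: contra_not xinf; exact: card_le_finite.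
  apply: (card_le_trans (card_le_setX xz xz)); apply: (card_le_trans (IH z zx zinf)).
  exact/subset_card_le/segS.
have [mx mxP] := choice (fun p : W * W => strict_well_order_ex_max p.1 p.2 lto).
pose S := segment lt x `*` segment lt x.
pose code (p : S) := (mx (val p), val p).
have code_inj : injective code by move=> p q [_ /val_inj].
pose lex3 : W * (W * W) -> W * (W * W) -> Prop := lexicographic lt (lexicographic lt lt).
have lex3o : strict_well_order lex3.
  apply: strict_well_order_lexicographic; first exact: lto.
  apply: strict_well_order_lexicographic; exact: lto.
pose ltG p q := lex3 (code p) (code q).
have ltGo : strict_well_order ltG := strict_well_order_pullback code_inj lex3o.
have [SA|[p Ap]] := well_order_comparability (segment lt x) ltGo.
  by apply: card_le_trans SA; have := card_setT_sym S; rewrite card_eq_le => /andP[].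
have mpx : lt (mx (val p)) x.
  by have [/= p1 p2] := set_valP p; have [[->|->]] := mxP (val p).
set m := mx (val p) in mpx.
pose M := m |` segment lt m.
have xMM : segment lt x #<= M `*` M.
  apply: (card_le_trans Ap); apply: (@card_le_inj _ _ _ _ val).
    move=> q qp; have qm : ~ lt m (mx (val q)).
      move: qp; rewrite /segment /= /ltG /lex3 /code /lexicographic /= -/m.
      move=> [qm|[-> _]]; first exact: strict_well_order_asym qm.
      exact: strict_well_order_irr.
    have [_ q1 q2] := mxP (val q).
    have below y : ~ lt (mx (val q)) y -> M y.
      move=> qy; case: (tri y m) => [ym|->|my]; [by right|by left|].
      case: qm; case: (tri (mx (val q)) y) => [//|->//|yq].
      exact: strict_well_order_trans yq.
    by split; apply: below.
  by move=> q q' _ _ /val_inj.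
exfalso; have [mfin|minf] := pselect (finite_set (segment lt m)).
  apply/xinf/(card_le_finite xMM)/finite_setX; by rewrite /M finite_setU; split.
apply: init; exists m => //; apply: (card_le_trans xMM).
have Mm : M #<= segment lt m by exact: infinite_setU1.
exact: (card_le_trans (card_le_setX Mm Mm) (IH m mpx minf)).
Qed.

Definition strict K (le : rel K) (x y : K) : Prop := le x y /\ x <> y.

Lemma well_order_strict K (le : rel K) :
  wochoice.well_order le -> strict_well_order (strict le).
Proof.
move=> wo.
have minP (P : K -> Prop) : (exists x, P x) -> exists2 z, P z & forall y, P y -> le z y.
  move=> [x Px]; have [|z [[zP zmin] _]] := wo (fun x => `[< P x >]).
    by exists x; apply/asboolP.
  by exists z => [|y Py]; [exact/asboolP|apply: zmin; exact/asboolP].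
have tot x y : le x y \/ le y x.
  have [|z [->|->] zmin] := minP (fun z => z = x \/ z = y); first by exists x; left.
    by left; apply: zmin; right.
  by right; apply: zmin; left.
have refl x : le x x by case: (tot x x).
have anti x y : le x y -> le y x -> x = y.
  move=> xy yx; have [|z [_ uniq]] := wo (fun z => `[< z = x \/ z = y >]).
    by exists x; apply/asboolP; left.
  rewrite -(uniq x) ?(uniq y) //; split; try by apply/asboolP; auto.
    by move=> t /asboolP [->|->].
  by move=> t /asboolP [->|->].
split; last first.
  move=> x y; have [->|xy] := pselect (x = y); first by constructor 2.
  by case: (tot x y) => ?; [constructor 1|constructor 3]; split => // /esym.
move=> x; apply: contrapT => xacc.
have [|z zacc zmin] := minP (fun x => ~ Acc (strict le) x); first by exists x.
apply: zacc; constructor => y [yz neq]; apply: contrapT => /zmin zy.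
by apply: neq; apply: anti.
Qed.

Lemma strict_total K (le : rel K) x y :
  wochoice.well_order le -> ~ strict le x y -> le y x.
Proof.
move=> wo; have lto := well_order_strict wo; have [_ tri] := lto.
case: (tri x y) => [//|->|[]//] _.
have [|z [[/asboolP -> zmin] _]] := wo (fun z => `[< z = y >]).
  by exists y; apply/asboolP.
by apply: zmin; apply/asboolP.
Qed.

Lemma well_order_trans K (le : rel K) x y z :
  wochoice.well_order le -> le x y -> le y z -> le x z.
Proof.
move=> wo xy yz; have lto := well_order_strict wo.
have [->//|nxy] := pselect (x = y); have [<-//|nyz] := pselect (y = z).
exact: (strict_well_order_trans lto (conj xy nxy) (conj yz nyz)).1.
Qed.

(** * The ideal of sets smaller than a cardinal of uncountable cofinality *)

Section SmallSets.
Context (K : Type) (le : rel K).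
Hypotheses (cardK : is_cardinal le) (infK : infinite_set [set: K])
  (cofK : uncountable_cofinality le).

Local Notation lt := (strict le).

(** As cardinals are comparable, this says that [A] has fewer elements than [K].
    A set that is not small is called large. *)
Definition small T (A : set T) := ~ ([set: K] #<= A).

Let wo : wochoice.well_order le := proj1 cardK.
Let lto : strict_well_order lt := well_order_strict wo.
Let leNlt x y : ~ lt x y -> le y x := @strict_total _ _ x y wo.
Let le_refl x : le x x := leNlt (@strict_well_order_irr _ _ x lto).
Let le_trans x y z : le x y -> le y z -> le x z := @well_order_trans _ _ x y z wo.

Lemma segmentS x y : le x y -> segment lt x `<=` segment lt y.
Proof.
move=> xy z zx; have [<-//|nxy] := pselect (x = y).
exact: (strict_well_order_trans lto zx (conj xy nxy)).
Qed.

Lemma inhabited_cardinal : $|K|.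
Proof. by have [x _] := infinite_setN0 infK; squash x. Qed.

Lemma small_le T U (A : set T) (B : set U) : A #<= B -> small B -> small A.
Proof. by move=> AB; apply: contra_not => /card_le_trans; apply. Qed.

Lemma small_segment x : small (segment lt x).
Proof.
move=> Kx; have /negP := proj2 cardK x; apply; apply: card_esym.
by rewrite card_eq_le Kx card_leT.
Qed.

Lemma small_le_segment T (A : set T) : small A -> exists x, A #<= segment lt x.
Proof. by move=> sA; case: (well_order_comparability A lto). Qed.

Lemma small_finite T (A : set T) : finite_set A -> small A.
Proof. by move=> finA /card_le_finite /(_ finA). Qed.

Lemma small_setX T U (A : set T) (B : set U) : small A -> small B -> small (A `*` B).
Proof.
move=> /small_le_segment[x Ax] /small_le_segment[y By].
have [z [_ zx zy]] := strict_well_order_ex_max x y lto.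
have Az : A #<= segment lt z.
  by apply/(card_le_trans Ax)/subset_card_le/segmentS/leNlt.
have Bz : B #<= segment lt z.
  by apply/(card_le_trans By)/subset_card_le/segmentS/leNlt.
apply: (small_le (card_le_setX Az Bz)).
have [zfin|zinf] := pselect (finite_set (segment lt z)).
  exact/small_finite/finite_setX.
exact: small_le (segment_square lto zinf) (@small_segment z).
Qed.

(** Small cardinalities of the [F d] would not suffice: for a singular cardinal
    they have to be bounded by a common segment. *)
Lemma small_bigcup D T (A : set D) (F : D -> set T) x :
  small A -> (forall d, A d -> F d #<= segment lt x) -> small (\bigcup_(d in A) F d).
Proof.
move=> sA Fx; have [k0] := inhabited_cardinal.
have /choice[f fP] (d : D) :
    exists g : T -> K, A d -> set_fun (F d) (segment lt x) g /\ set_inj (F d) g.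
  have [Ad|nAd] := pselect (A d); last by exists (fun=> k0).
  by have [g] := card_le_exists_inj k0 (Fx d Ad); exists g.
have [[_ [d0 _ _]]|/nonemptyPn ->] := pselect (\bigcup_(d in A) F d !=set0); last first.
  exact/small_finite.
have /choice[c cP] (t : T) :
    exists d, (\bigcup_(d in A) F d) t -> A d /\ F d t.
  by have [[d Ad Fdt]|] := pselect ((\bigcup_(d in A) F d) t); [exists d|exists d0].
apply: small_le (small_setX sA (@small_segment x)).
apply: (@card_le_inj _ _ _ _ (fun t => (c t, f (c t) t))).
  move=> t /cP[Act Fct]; split => //=; exact: (proj1 (fP _ Act)).
move=> s t /set_mem /cP [Acs Fcs] /set_mem /cP [Act Fct] [cst].
by rewrite cst => /(proj2 (fP _ Act)); apply; rewrite inE // -cst.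
Qed.

Lemma cofinality_uncountable B : countable B -> ~ cofinal le B.
Proof.
move=> cB cofB; have [A [_ leastA] ncA] := cofK; apply: ncA.
exact: sub_countable (leastA B cofB) cB.
Qed.

Lemma not_cofinal_ubound B : ~ cofinal le B -> exists z, forall b, B b -> le b z.
Proof.
move=> /existsNP[z zB]; exists z => b Bb; apply: leNlt => -[zb _].
by apply: zB; exists b.
Qed.

Lemma small_countable T (A : set T) : countable A -> small A.
Proof.
move=> cA KA; apply: (@cofinality_uncountable [set: K]); first exact: sub_countable cA.
by move=> x; exists x.
Qed.

(** Countably many bounds are not cofinal, so that all the [F p] embed in one and
    the same segment. *)
Lemma small_bigcup_countable P T (F : P -> set T) :
  countable [set: P] -> (forall p, small (F p)) -> small (\bigcup_p F p).
Proof.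
move=> cP sF; have /choice[b bP] := fun p => small_le_segment (sF p).
have [|z zP] := @not_cofinal_ubound (range b).
  by apply: cofinality_uncountable; apply: sub_countable cP; exact: card_image_le.
apply: (@small_bigcup _ _ _ _ z); first exact: small_countable.
move=> p _; apply/(card_le_trans (bP p))/subset_card_le/segmentS/zP.
by exists p.
Qed.

Lemma large_fiber P T (c : T -> P) (L : set T) :
  countable [set: P] -> ~ small L -> exists p, ~ small (L `&` c @^-1` [set p]).
Proof.
move=> cP lL; apply: contrapT => /forallNP sF; apply: lL.
apply: (@small_le _ _ _ (\bigcup_p (L `&` c @^-1` [set p]))).
  by apply: subset_card_le => t Lt; exists (c t).
by apply: small_bigcup_countable => // p; apply: contrapT; exact: sF.
Qed.

Lemma small_setU T (A B : set T) : small A -> small B -> small (A `|` B).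
Proof.
move=> sA sB; apply: (@small_le _ _ _ (\bigcup_(b : bool) if b then A else B)).
  by apply: subset_card_le => t [At|Bt]; [exists true|exists false].
by apply: small_bigcup_countable => // -[].
Qed.

(** Build a clique greedily along [K]. A stage that cannot be completed yields the
    small set [D], made of the elements chosen before it. *)
Lemma large_clique T (L : set T) (C : T -> T -> Prop) :
  (forall s t, C s t -> C t s) -> (forall t, L t -> C t t) ->
  (exists J : set T, [/\ J `<=` L, ~ small J & forall s t, J s -> J t -> C s t]) \/
  exists D : set T, small D /\
    forall t, L t -> exists2 s, D s & s = t \/ ~ C s t.
Proof.
move=> Csym Crefl; have [wf tri] := lto.
have [[t0 _]|/nonemptyPn L0] := pselect (L !=set0); last first.
  by right; exists set0; split; [exact/small_finite|rewrite L0].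
have [h hP] := greedy t0 (fun=> L) (fun s t => s <> t /\ C s t) wf.
have [total|] := pselect (forall w, exists2 t, L t & forall v, lt v w -> h v <> t /\ C (h v) t).
  left; exists (range h); split.
  - by move=> _ [w _ <-]; case: (hP w (total w)).
  - apply; apply: (@card_le_inj _ _ _ _ h) => [w _|v w _ _ hvw]; first by exists w.
    case: (tri v w) => // [vw|wv].
      by have [_ /(_ v vw)[]] := hP w (total w).
    by have [_ /(_ w wv)[]] := hP v (total v); rewrite hvw.
  - move=> _ _ [v _ <-] [w _ <-].
    have [Lhv vP] := hP v (total v); have [Lhw wP] := hP w (total w).
    case: (tri v w) => [/wP[]//|->|/vP[_ /Csym]//]; exact: Crefl.
move=> /existsNP[w nw]; right; exists (h @` segment lt w); split.
  exact: small_le (card_image_le _ _) (@small_segment w).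
move=> t Lt; apply: contrapT => nt; apply: nw; exists t => // v vw.
split; first by move=> hvt; apply: nt; exists (h v); [exists v|left].
by apply: contrapT => nC; apply: nt; exists (h v); [exists v|right].
Qed.

(** If each element is compatible with all sufficiently large ones, then a clique
    of length cf(K) can be chosen greedily: fewer than cf(K) bounds never form a
    cofinal set, so that a choice exists at every stage. The stages are indexed
    by an initial ordinal [W] of the same cardinality as a least cofinal set [A],
    because [A] itself may have proper initial segments as large as [A]. *)
Lemma cofinal_clique (C : K -> K -> Prop) :
  (forall x y, C x y -> C y x) -> (forall x, C x x) ->
  (forall x, exists z, forall y, le z y -> C x y) ->
  exists2 B, cofinal le B & forall x y, B x -> B y -> C x y.
Proof.
move=> Csym Crefl /choice[b bP]; have [wf tri] := lto.
have [A [cofA leastA] _] := cofK.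
have [k0] := inhabited_cardinal.
(* [W] is the shortest initial segment of [K] in which [A] embeds. *)
have [W [AW Winit]] : exists W : set K,
    A #<= W /\ forall x, W x -> ~ (A #<= segment lt x).
  pose P x := A #<= segment lt x.
  have [[x]|nP] := pselect (exists x, P x); last first.
    by exists setT; split => [|x _ Ax]; [exact: card_leT|apply: nP; exists x].
  elim/(well_founded_ind wf): x => x IH Px.
  have [[y yx Py]|nP] := pselect (exists2 y, lt y x & P y); first exact: IH Py.
  exists (segment lt x); split => // y yx Ay.
  by apply: nP; exists y.
have [a0 Aa0 _] := cofA k0.
have /pfcard_geP[A0|[e]] := AW; first by rewrite A0 in Aa0.
(* [e] maps [W] onto [A]; keeping [h w] above [e w] makes the clique cofinal. *)
have [h hP] := greedy k0 (fun w => [set x | le (e w) x]) C wf.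
have total w : W w ->
    exists2 x, le (e w) x & forall v, lt v w -> C (h v) x.
  move=> Ww; have [|z zP] := @not_cofinal_ubound (b @` (h @` segment lt w)).
    move=> /leastA Aw; apply: (Winit w Ww); apply: (card_le_trans Aw).
    exact: card_le_trans (card_image_le _ _) (card_image_le _ _).
  have [x [_ xz xe]] := strict_well_order_ex_max z (e w) lto.
  exists x; first exact: leNlt.
  move=> v vw; apply: bP; apply: le_trans (leNlt xz).
  by apply: zP; exists (h v) => //; exists v.
exists (h @` W).
  move=> x; have [a Aa xa] := cofA x; have [w Ww ewa] := @surj _ _ _ _ e a Aa.
  exists (h w); first by exists w.
  have [ehw _] := hP w (total w Ww).
  by apply: le_trans xa _; rewrite -ewa.
move=> _ _ [v Wv <-] [w Ww <-].
have [_ vP] := hP v (total v Wv); have [_ wP] := hP w (total w Ww).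
by case: (tri v w) => [/wP//|->|/vP/Csym].
Qed.
End SmallSets.

(** * Separation in metric spaces *)

Section Separation.
Context (K : Type) (le : rel K).
Hypotheses (cardK : is_cardinal le) (infK : infinite_set [set: K])
  (cofK : uncountable_cofinality le).
Context (R : realType) (Y : metricType R).

Local Notation lt := (strict le).
Local Notation small := (@small K).
Local Notation dist := (@mdist R Y).

(** If cofinally many [u k] lie in one ball of radius [e], the corresponding
    [v k] are far from its centre, and these [k] form the required set; the
    same holds with [u] and [v] exchanged. Otherwise the points that conflict
    with a given one have bounded indices, which is the hypothesis of
    [cofinal_clique]. *)
Lemma cofinal_separation (u v : K -> Y) (e : R) :
  0 < e -> (forall k, 3 * e <= dist (u k) (v k)) ->
  exists2 B, cofinal le B & forall k l, B k -> B l -> e <= dist (u k) (v l).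
Proof.
move=> e0 uv; pose near (w : K -> Y) p := [set k | dist (w k) p < e].
have [[p pu]|nu] := pselect (exists p, cofinal le (near u p)).
  exists (near u p) => // k l; rewrite /near /= => uk ul.
  have := uv l; have := metric_triangle (u l) p (v l).
  have := metric_triangle p (u k) (v l); rewrite (metric_sym p (u k)); lra.
have [[p pv]|nv] := pselect (exists p, cofinal le (near v p)).
  exists (near v p) => // k l; rewrite /near /= => vk vl.
  have := uv k; have := metric_triangle (u k) p (v k).
  have := metric_triangle (u k) (v l) p; rewrite (metric_sym p (v k)); lra.
pose C k l := e <= dist (u k) (v l) /\ e <= dist (u l) (v k).
have [|k|k|B cofB BC] := cofinal_clique cardK infK cofK (C := C).
- by move=> k l [].
- by split; have := uv k; lra.
- have /existsNP[z zP] : ~ cofinal le (near v (u k)) by move=> ?; apply: nv; exists (u k).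
  have /existsNP[z' zP'] : ~ cofinal le (near u (v k)) by move=> ?; apply: nu; exists (v k).
  have [m [_ mz mz']] := strict_well_order_ex_max z z' (well_order_strict (proj1 cardK)).
  exists m => l ml; split; rewrite leNgt; apply/negP => lk.
    apply: zP; exists l; first by rewrite /near /= metric_sym.
    exact: well_order_trans (proj1 cardK) (strict_total (proj1 cardK) mz) ml.
  apply: zP'; exists l => //.
  exact: well_order_trans (proj1 cardK) (strict_total (proj1 cardK) mz') ml.
by exists B => // k l Bk Bl; case: (BC k l Bk Bl).
Qed.

Section Pairs.
Context (I : Type).
Implicit Types (L J : set I) (x y : I -> Y) (r e : R).

(** For each [k] some code [t k] has more preimages than there are elements below
    [k], since otherwise [L] would be a small union of sets bounded by [k]. Hence
    the preimages of the [t k] over any cofinal set of [k] form a large set, and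
    only the codes need to be separated. The inequality between [x i] and [y i]
    leaves 11 r - 2 r = 3 (3 r) between the components of a code; separating
    these by 3 r leaves 3 r - 2 r between the points. *)
Lemma separation_coded L x y r (c : I -> Y * Y) (D : set (Y * Y)) :
  ~ small L -> 0 < r -> small D -> (forall i, L i -> D (c i)) ->
  (forall i, L i -> dist (x i) (c i).1 < r) ->
  (forall i, L i -> dist (y i) (c i).2 < r) ->
  (forall i, L i -> 11 * r <= dist (x i) (y i)) ->
  exists2 J, J `<=` L & ~ small J /\ forall i j, J i -> J j -> r <= dist (x i) (y j).
Proof.
move=> lL r0 sD cD xc yc xy.
pose F t := L `&` c @^-1` [set t].
have /choice[t tP] (k : K) : exists t, ~ (F t #<= segment lt k).
  apply: contrapT => /forallNP nF; apply: lL.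
  apply: (@small_le _ _ _ _ (\bigcup_(t in D) F t)).
    by apply: subset_card_le => i Li; exists (c i); [exact: cD|].
  apply: (small_bigcup cardK infK (x := k)) => // t _.
  by apply: contrapT; exact: nF.
have [|k|B cofB BP] := @cofinal_separation (fst \o t) (snd \o t) (3 * r).
- lra.
- have [[i [Li ci]]|/nonemptyPn F0] := pselect (F (t k) !=set0); last first.
    by case: (tP k); rewrite F0; exact: card_ge0.
  have := xc i Li; have := yc i Li; have := xy i Li; rewrite /= in ci *; rewrite ci.
  have := metric_triangle (x i) (t k).1 (y i); rewrite (metric_sym (y i)).
  have := metric_triangle (t k).1 (t k).2 (y i); lra.
exists (\bigcup_(k in B) F (t k)); first by move=> i [k _ []].
split.
  move=> /(small_le_segment cardK)[b Jb]; have [k Bk bk] := cofB b.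
  apply: (tP k); apply: card_le_trans (subset_card_le (segmentS cardK bk)).
  by apply: card_le_trans Jb; apply: subset_card_le => i Fi; exists k.
move=> i j [k Bk [Li ci]] [l Bl [Lj cj]]; have := BP k l Bk Bl.
have := xc i Li; have := yc j Lj; rewrite /= in ci cj *; rewrite ci cj.
have := metric_triangle (t k).1 (x i) (t l).2; rewrite (metric_sym _ (x i)).
have := metric_triangle (x i) (y j) (t l).2; lra.
Qed.

(** Either many [y i] stay at distance 2 r from [D], hence at distance r from
    every [x j], or many pairs are within 2 r of a pair of points of [D], and
    [separation_coded] applies with 2 r instead of [r], whence the factor
    22 = 11 * 2. *)
Lemma separation_dominated L x y r (D : set Y) :
  ~ small L -> 0 < r -> small D ->
  (forall i, L i -> exists2 p, D p & dist (x i) p < r) ->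
  (forall i, L i -> 22 * r <= dist (x i) (y i)) ->
  exists2 J, J `<=` L & ~ small J /\ forall i j, J i -> J j -> r <= dist (x i) (y j).
Proof.
move=> lL r0 sD xD xy.
pose A := [set i | L i /\ forall p, D p -> 2 * r <= dist (y i) p].
have [sA|lA] := pselect (small A); last first.
  exists A; first by move=> i [].
  split=> // i j [Li _] [_ yD]; have [p Dp xp] := xD i Li.
  have := yD p Dp; have := metric_triangle (y j) (x i) p.
  rewrite (metric_sym (y j) (x i)); lra.
have lLA : ~ small (L `\` A).
  move=> sLA; apply: lL.
  apply: small_le (small_setU cardK infK cofK sA sLA); apply: subset_card_le => i Li.
  by have [Ai|nAi] := pselect (A i); [left|right].
have /choice[c cP] (i : I) : exists c : Y * Y, (L `\` A) i ->
    [/\ (D `*` D) c, dist (x i) c.1 < 2 * r & dist (y i) c.2 < 2 * r].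
  have [[Li nAi]|ni] := pselect ((L `\` A) i); last by exists (x i, x i).
  have [p Dp xp] := xD i Li.
  have [q Dq yq] : exists2 q, D q & dist (y i) q < 2 * r.
    apply: contrapT => nq; apply: nAi; split=> // q Dq; rewrite leNgt.
    by apply/negP => yq; apply: nq; exists q.
  by exists (p, q) => _; split=> //=; lra.
have [||||||J JL [lJ JP]] := @separation_coded (L `\` A) x y (2 * r) c (D `*` D) lLA.
- lra.
- exact: (small_setX cardK infK sD sD).
- by move=> i /cP[].
- by move=> i /cP[].
- by move=> i /cP[].
- by move=> i [/xy]; lra.
exists J; first by move=> i /JL[].
by split=> // i j Ji Jj; have := JP i j Ji Jj; lra.
Qed.

(** When no large clique exists, each index in [L] conflicts with one from a small
    set or belongs to it. The conflict is due to [x] being close to a value of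
    [y], or conversely, and one of these cases covers a large part of [L]. *)
Lemma separation L x y e :
  ~ small L -> 0 < e -> (forall i, L i -> e <= dist (x i) (y i)) ->
  exists2 r, 0 < r & exists2 J, J `<=` L &
    ~ small J /\ forall i j, J i -> J j -> r <= dist (x i) (y j).
Proof.
move=> lL e0 xy; exists (e / 22); first lra.
set r := e / 22; have r0 : 0 < r by rewrite /r; lra.
have xyr i : L i -> 22 * r <= dist (x i) (y i) by move=> /xy; rewrite /r; lra.
pose C i j := r <= dist (x i) (y j) /\ r <= dist (x j) (y i).
have [||[J [JL lJ JC]]|[D [sD LD]]] := large_clique cardK infK (L := L) (C := C).
- by move=> i j [].
- by move=> i /xyr; rewrite /C; lra.
- by exists J => //; split=> // i j Ji Jj; case: (JC i j Ji Jj).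
pose Lx := [set i | L i /\ exists2 p, (y @` D) p & dist (x i) p < r].
pose Ly := [set i | L i /\ exists2 p, (x @` D) p & dist (y i) p < r].
have [sLx|lLx] := pselect (small Lx); last first.
  have [|i []|i []|J JL JP] := @separation_dominated Lx x y r (y @` D) lLx r0 => //.
  - exact: small_le (card_image_le _ _) sD.
  - by move=> /xyr.
  by exists J => // i /JL[].
have [sLy|lLy] := pselect (small Ly); last first.
  have [|i []|i []|J JL [lJ JP]] := @separation_dominated Ly y x r (x @` D) lLy r0 => //.
  - exact: small_le (card_image_le _ _) sD.
  - by move=> /xyr; rewrite metric_sym.
  exists J; first by move=> i /JL[].
  by split=> // i j Ji Jj; rewrite metric_sym; exact: JP.
exfalso; apply: lL.
have := small_setU cardK infK cofK sD (small_setU cardK infK cofK sLx sLy).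
apply: small_le; apply: subset_card_le => i Li; have [j Dj [<-|nC]] := LD i Li; first by left.
right; have [xi|xi] := ltP (dist (x i) (y j)) r.
  by left; split=> //; exists (y j) => //; exists j.
right; split=> //; exists (x j); first by exists j.
by rewrite metric_sym ltNge; apply/negP => ji; apply: nC.
Qed.

Lemma separation_seq (A : eqType) (x : A -> I -> Y) (s : seq (A * A)) L e :
  ~ small L -> 0 < e ->
  (forall p i, p \in s -> L i -> e <= dist (x p.1 i) (x p.2 i)) ->
  exists2 r, 0 < r & exists2 J, J `<=` L &
    ~ small J /\ forall p i j, p \in s -> J i -> J j -> r <= dist (x p.1 i) (x p.2 j).
Proof.
move=> lL e0; elim: s => [_|p s IH sep].
  by exists 1 => //; exists L.
have [q i qs|r r0 [J JL [lJ JP]]] := IH; first by apply: sep; rewrite inE qs orbT.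
have [i /JL Li|r' r'0 [J' JJ' [lJ' JP']]] := separation lJ e0 (x := x p.1) (y := x p.2).
  by apply: sep => //; rewrite mem_head.
exists (Num.min r r'); first by rewrite lt_min r0.
exists J'; first exact: subset_trans JL.
split=> // q i j; rewrite inE => /orP[/eqP->|qs] Ji Jj; rewrite ge_min.
  by rewrite JP' ?orbT.
by rewrite JP //; exact: JJ'.
Qed.

End Pairs.
End Separation.

(** * Pointwise convergence and interpolation *)

(** The sets [V] satisfying the conclusion form a filter which converges to [f]
    at each point, hence in the topology of pointwise convergence. *)
Lemma ptws_nbhs_finite (R : realType) (X : topologicalType) (f : {ptws X -> R})
    (V : set {ptws X -> R}) : nbhs f V ->
  exists s : seq X, exists2 e : R, 0 < e &
    forall g : {ptws X -> R}, (forall x, x \in s -> `|f x - g x| < e) -> V g.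
Proof.
pose G := [set V : set {ptws X -> R} | exists s : seq X, exists2 e : R, 0 < e &
    forall g : {ptws X -> R}, (forall x, x \in s -> `|f x - g x| < e) -> V g].
have GF : Filter G.
  split; first by exists [::]; exists 1.
    move=> A B [s [e e0 sA]] [t [e' e'0 tB]].
    exists (s ++ t); exists (Num.min e e'); first by rewrite lt_min e0.
    move=> g gP; split; [apply: sA|apply: tB] => x xs; apply: (lt_le_trans (gP x _)).
    + by rewrite mem_cat xs.
    + by rewrite ge_min lexx.
    + by rewrite mem_cat xs orbT.
    + by rewrite ge_min lexx orbT.
  move=> A B AB [s [e e0 sA]]; exists s; exists e => // g /sA; exact: AB.
suff : {ptws, G --> f} by move=> Gf /Gf.
apply/(@pointwise_cvgP X R) => t A /nbhs_ballP[e /= e0 eA].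
by exists [:: t]; exists e => // g gP; apply: eA; apply: gP; rewrite inE.
Qed.

Lemma Cp_open_rational (R : realType) (X : topologicalType) (x0 : X) (U : set (Cp R X)) :
  open U -> U !=set0 ->
  exists (s : seq X) (q : seq rat), [/\ uniq s, size q = size s &
    forall g : Cp R X,
      (forall a, (a < size s)%N -> set_val g (nth x0 s a) = ratr (nth 0 q a)) -> U g].
Proof.
move=> [V oV <-] [f Vf].
have [s [e e0 sV]] := ptws_nbhs_finite (open_nbhs_nbhs (conj oV Vf)).
have /choice[q qP] x : exists q : rat, `|set_val f x - ratr q| < e.
  have [|q] := @rat_in_itvoo R (set_val f x) (set_val f x + e); first by rewrite ltrDl.
  rewrite in_itv /= => /andP[q1 q2]; exists q.
  by rewrite distrC ltr_distlC; apply/andP; split; lra.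
exists (undup s), (map q (undup s)); split; [exact: undup_uniq|exact: size_map|].
move=> g gq; apply: sV => x; rewrite -mem_undup => xs.
have := gq (index x (undup s)); rewrite index_mem => /(_ xs).
rewrite (nth_map x0) ?index_mem // nth_index // => ->; exact: qP.
Qed.

(** Add up Urysohn functions equal to 1 on one of the sets and to 0 on all the
    others, with coefficients [q a]. *)
Lemma separated_interpolation (R : realType) (Y : metricType R) (A : finType)
    (P : A -> set Y) (q : A -> R) (r : R) :
  0 < r ->
  (forall a b, a != b -> forall y z, P a y -> P b z -> r <= mdist y z) ->
  exists g : Y -> R, continuous g /\ forall a y, P a y -> g y = q a.
Proof.
move=> r0 sep; pose w a := Urysohn (\bigcup_(b in [set b | b != a]) P b) (P a) : Y -> R.
have wsep a : uniform_separator (\bigcup_(b in [set b | b != a]) P b) (P a).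
  apply: uniform_separatorW; exists [set p | ball p.1 r p.2].
    exact: entourage_ball (PosNum r0).
  apply/seteqP; split=> // -[y z] /= [[[b /= ba Pby] Paz]].
  by rewrite ballEmdist /= ltNge (sep b a).
exists (fun y => \sum_a q a * w a y); split.
  apply: continuous_big => [|a _ y]; first exact: add_continuous.
  by apply: cvgM; [exact: cvg_cst|exact: Urysohn_continuous].
move=> a y Pay; rewrite (bigD1 a) //= big1 ?addr0.
  rewrite (_ : w a y = 1) ?mulr1 //; apply: (Urysohn_sub1 (wsep a)); by exists y.
move=> b ba; rewrite (_ : w b y = 0) ?mulr0 //; apply: (Urysohn_sub0 (wsep b)).
by exists y => //; exists a => //=; rewrite eq_sym.
Qed.

Lemma uniform_positive_bound (R : realType) (T : eqType) (s : seq T) (P : T -> R) :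
  (forall t, t \in s -> 0 < P t) -> exists m, forall t, t \in s -> m.+1%:R^-1 <= P t.
Proof.
move=> Ppos.
suff /filter_ex : \forall m \near \oo, forall t, t \in s -> m.+1%:R^-1 <= P t by [].
elim: s Ppos => [_|t s IH Ppos]; first exact: nearW.
have Pt : 0 < P t by apply: Ppos; rewrite mem_head.
near=> m => u; rewrite inE => /orP[/eqP->|].
  by apply/ltW; near: m; exact: (near_infty_natSinv_lt (PosNum Pt)).
by move: u; near: m; apply: IH => u us; apply: Ppos; rewrite inE us orbT.
Unshelve. all: by end_near.
Qed.

Theorem theorem4p9 (R : realType) (X : topologicalType)
  (tychonoffX : tychonoff_space X) (submetrizableX : submetrizable R X) :
  strongly_sanin (Cp R X).
Proof.
move=> K le cardK infK cofK I U IK Uopen.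
suff [J lJ [g gU]] : exists2 J : set I, ~ @small K _ J & \bigcap_(i in J) U i !=set0.
  exists J; split; last by exists g.
  rewrite card_eq_le (contrapT lJ) andbT; apply: (card_le_trans (card_leT J)).
  by have := IK; rewrite card_eq_le => /andP[].
have lI : ~ @small K _ [set: I].
  by apply; have := IK; rewrite card_eq_le => /andP[].
(* If [X] is empty, all the [U i] are equal to the one-point space. *)
have [[x0 _]|/nonemptyPn X0] := pselect ([set: X] !=set0); last first.
  have [[i0 _]|/nonemptyPn I0] := pselect ([set: I] !=set0); last first.
    by case: lI; rewrite I0; exact: small_finite.
  have [_ [f Uf]] := Uopen i0; exists setT => //; exists f => i _.
  have [_ [g Ug]] := Uopen i; suff -> : f = g by [].
  apply/val_inj/funext => x; exfalso.
  by have : [set: X] x by []; rewrite X0.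
have [Y [phi [phiC /bij_inj phi_inj]]] := submetrizableX.
have /choice[s sP] i : exists s : seq X, exists q : seq rat, [/\ uniq s, size q = size s &
    forall g : Cp R X,
      (forall a, (a < size s)%N -> set_val g (nth x0 s a) = ratr (nth 0 q a)) -> U i g].
  by have [oU nU] := Uopen i; exact: Cp_open_rational.
have {sP} /choice[q qP] := sP.
have /choice[m mP] i : exists m, forall p,
      p \in [seq p <- [seq (x, y) | x <- s i, y <- s i] | p.1 != p.2] ->
    m.+1%:R^-1 <= mdist (phi p.1) (phi p.2).
  apply: (uniform_positive_bound (P := fun p => mdist (phi p.1) (phi p.2))) => p.
  by rewrite mem_filter mdist_gt0 => /andP[+ _]; apply: contra_neq => /phi_inj.
have [[qs n] lL] := large_fiber cardK infK cofK (fun i => (q i, m i))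
  (countableP _) lI.
set L := _ `&` _ in lL.
pose x (a : 'I_(size qs)) i := phi (nth x0 (s i) a).
have [|p i|r r0 [J JL [lJ JP]]] := separation_seq cardK infK cofK (x := x)
    (s := [seq p <- enum {: 'I_(size qs) * 'I_(size qs)} | p.1 != p.2])
    (e := n.+1%:R^-1) lL.
- by rewrite invr_gt0.
- rewrite mem_filter => /andP[p12 _] [_ [qi <-]]; have [us sizeq _] := qP i.
  have lt_size (a : 'I_(size qs)) : (a < size (s i))%N by rewrite -sizeq qi.
  apply: (mP i (nth x0 (s i) p.1, nth x0 (s i) p.2)).
  rewrite mem_filter /= nth_uniq // p12 /=.
  by apply: allpairs_f; exact: mem_nth.
exists J => //.
have [|g [gC gq]] := @separated_interpolation R Y _ (fun a => x a @` J)
    (fun a => ratr (nth 0 qs a)) r r0.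
  move=> a b ab _ _ [i Ji <-] [j Jj <-]; apply: (JP (a, b)) => //.
  by rewrite mem_filter ab mem_enum.
have gphiC : [set f : {ptws X -> R} | continuous (f : X -> R)] (g \o phi).
  move=> y; apply: continuous_comp; [exact: phiC|exact: gC].
exists (SigSub (mem_set gphiC)) => i Ji; have [_ sizeq Ui] := qP i.
apply: Ui => a; rewrite -sizeq; have [_ [-> _]] := JL i Ji => aq.
by apply: (gq (Ordinal aq)); exists i.
Qed.
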